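(* Let $m\ge 1$, let $\Upsilon_m=\{\tilde z_k\}_{k=0}^{m-1}\subset\mathbb{T}$ be an arbitrary set with $\tilde z_i\ne\tilde z_j$ for $i\ne j$, let $\nu_0,\dots,\nu_{m-1}$ be positive integers, put $r=\sum_{k=0}^{m-1}\nu_k$, let $p$ be an integer with $0\le p\le r-1$, and let $\zeta_k^{(l_k)}$, $k=0,\dots,m-1$, $l_k=0,\dots,\nu_k-1$, be arbitrary complex values. Then there exists a unique Laurent polynomial $P_m\in\Lambda_{-p,r-p-1}$ satisfying $$P_m^{(l_k)}(\tilde z_k)=\zeta_k^{(l_k)},\qquad k=0,1,\dots,m-1,\quad l_k=0,1,\dots,\nu_k-1.$$
   Context: $\mathbb{T}=\{z\in\mathbb{C}:|z|=1\}$. For integers $a\le b$, $\Lambda_{a,b}=\operatorname{span}_{\mathbb{C}}\{z^a,\dots,z^b\}$ (Laurent polynomials with complex coefficients). $P^{(l)}$ denotes the $l$-th complex derivative with respect to $z$ (with $P^{(0)}=P$), whereas the superscript in $\zeta_k^{(l_k)}$ is only an index. *)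

(* Defs.v *)
From mathcomp Require Import all_boot all_order all_algebra.
From mathcomp Require Import boolp classical_sets functions reals.
From mathcomp Require Import topology normedtype derive.
From mathcomp Require Import complex.

Set Implicit Arguments.
Unset Strict Implicit.
Unset Printing Implicit Defensive.

Import Order.TTheory GRing.Theory Num.Theory numFieldNormedType.Exports.
Local Open Scope classical_set_scope.
Local Open Scope ring_scope.
Local Open Scope complex_scope.

(* The span of z^a, ..., z^b for a <= b, as functions of z.  A power z ^ j with
   j : int takes the conventional value (j == 0)%:R at z = 0; this value plays
   no role, since a Laurent polynomial is determined by its values off 0. *)
Definition Laurent (R : realType) (a b : int) : set (R[i] -> R[i]) :=
  [set P | exists c : nat -> R[i],
     P = fun z : R[i] => \sum_(j < `|b - a|.+1) c j * z ^ (a + j%:Z)].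

(* Main.v *)
Require Import Defs.
From HB Require Import structures.
From mathcomp Require Import all_boot all_order all_algebra.
From mathcomp Require Import boolp classical_sets functions reals.
From mathcomp Require Import topology normedtype derive.
From mathcomp Require Import complex.
From mathcomp Require Import zify ring.

(** Off 0, a Laurent polynomial in span (z^-p, ..., z^(r-p-1)) is z^-p Q(z) with
    Q an ordinary polynomial of degree less than r.  Differentiation preserves
    this shape:
      (z^-e Q)' = z^-(e+1) (z Q' - e Q),
    so the l-th derivative is z^-(p+l) times the value of a polynomial that
    depends linearly on Q ([ntwist p l Q] below).  Since the nodes are nonzero,
    the powers of z can be moved to the prescribed values, and the problem
    becomes a square linear system: r coefficients, r conditions.

    Such a system has a unique solution for all data as soon as the homogeneous
    one has only the zero solution.  If all data vanish, then Q has a zero of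
    order nu k at each node, exactly as for ordinary derivatives, because
    multiplication by a power of z does not change the order of a zero away
    from 0 ([dvdp_exp_ntwist]).  These factors are pairwise coprime, so their
    product, of degree r, divides Q; as Q has degree less than r, it is 0
    ([ntwist_interpolation_inj]). *)

Set Implicit Arguments.
Unset Strict Implicit.
Unset Printing Implicit Defensive.

Import Order.TTheory GRing.Theory Num.Theory numFieldNormedType.Exports.
Local Open Scope classical_set_scope.
Local Open Scope ring_scope.
Local Open Scope complex_scope.

(** The numerator of (z^-e Q)' over z^(e+1). *)
Definition twist (K : nzRingType) (e : nat) (Q : {poly K}) : {poly K} :=
  'X * Q^`() - Q *+ e.

(** The numerator of the l-th derivative of z^-e Q over z^(e+l); the exponent of
    the denominator grows by one at each differentiation. *)
Fixpoint ntwist (K : nzRingType) (e l : nat) (Q : {poly K}) : {poly K} :=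
  if l is l'.+1 then ntwist e.+1 l' (twist e Q) else Q.

Lemma ntwist_linear (K : comNzRingType) (e l : nat) :
  linear (@ntwist K e l).
Proof.
elim: l e => //= l IHl e a P Q; rewrite -IHl; congr ntwist.
rewrite /twist derivD derivZ mulrDr -scalerAr scalerBr mulrnDl opprD -scalerMnr.
by rewrite addrACA.
Qed.

HB.instance Definition _ (K : comNzRingType) e l :=
  GRing.isLinear.Build K {poly K} {poly K} _ (@ntwist K e l)
    (@ntwist_linear K e l).

(** If Q = (X - a)^n S with n > 0, then [twist e Q] is n X (X - a)^(n-1) S modulo
    (X - a)^n, and both X and n are invertible at a <> 0 in characteristic 0,
    so X - a divides S.  For n = 0 the step is the factor theorem. *)
Lemma dvdp_exp_twist (F : numFieldType) (a : F) (e n : nat) (Q : {poly F}) :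
  a != 0 -> Q.[a] = 0 -> ('X - a%:P) ^+ n %| Q ->
  ('X - a%:P) ^+ n %| twist e Q -> ('X - a%:P) ^+ n.+1 %| Q.
Proof.
move=> a0 Qa0 dQ dTQ.
case: n => [|n] in dQ dTQ *; first by rewrite expr1 dvdp_XsubCl; apply/rootP.
set q := 'X - a%:P in dQ dTQ *.
have q0 : q != 0 by rewrite polyXsubC_eq0.
have /dvdpP[S QE] := dQ.
have : q ^+ n.+1 %| 'X * Q^`().
  by move: dTQ; rewrite dvdp_subl // -mulr_natl dvdp_mull.
rewrite Gauss_dvdpr; last first.
  by rewrite coprimep_expl // coprimep_sym coprimep_XsubC rootX.
rewrite QE derivM deriv_exp derivXsubC mul1r /=.
rewrite dvdp_addr; last exact: dvdp_mull.
rewrite [X in X %| _]exprSr.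
rewrite mulrnAr -mulrnAl [X in _ %| X]mulrC dvdp_mul2l ?expf_neq0 //.
rewrite -scaler_nat dvdpZr ?pnatr_eq0 // => qS.
by rewrite [q ^+ n.+2]exprS dvdp_mul.
Qed.

(** The derivatives of z^-e Q of order less than n+1 include those of its
    derivative z^-(e+1) [twist e Q] of order less than n.  An induction on n for
    all e at once therefore applies both to Q and to [twist e Q], which are the
    two hypotheses of [dvdp_exp_twist]. *)
Lemma dvdp_exp_ntwist (F : numFieldType) (a : F) (e n : nat) (Q : {poly F}) :
  a != 0 -> (forall l, (l < n)%N -> (ntwist e l Q).[a] = 0) ->
  ('X - a%:P) ^+ n %| Q.
Proof.
move=> a0; elim: n e Q => [|n IHn] e Q L0; first by rewrite expr0 dvd1p.
apply: (@dvdp_exp_twist _ a e n Q) => //; first exact: (L0 0).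
  by apply: (IHn e) => l ln; apply: L0; rewrite ltnS ltnW.
by apply: (IHn e.+1) => l ln; apply: (L0 l.+1).
Qed.

Lemma dvdp_prod_XsubC_exp (F : fieldType) (I : eqType) (s : seq I)
    (a : I -> F) (nu : I -> nat) (Q : {poly F}) :
  uniq s -> {in s &, injective a} ->
  (forall i, i \in s -> ('X - (a i)%:P) ^+ nu i %| Q) ->
  \prod_(i <- s) ('X - (a i)%:P) ^+ nu i %| Q.
Proof.
elim: s => [|i s IHs] /=; first by rewrite big_nil dvd1p.
case/andP=> i_s us inja dQ; rewrite big_cons Gauss_dvdp.
  rewrite dQ ?mem_head //= IHs // => [|j js]; last by rewrite dQ // inE js orbT.
  by move=> j k js ks; apply: inja; rewrite inE ?js ?ks orbT.
rewrite coprimep_expl // coprimep_sym coprimep_XsubC.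
apply/negP => /rootP; rewrite horner_prod => /eqP; rewrite prodf_seq_eq0.
case/hasP => j js /=; rewrite horner_exp hornerXsubC expf_eq0 subr_eq0.
case/andP=> _ /eqP /inja; rewrite mem_head inE js orbT => /(_ isT isT) ij.
by rewrite ij js in i_s.
Qed.

Section Interpolation.
Variables (F : numFieldType) (m : nat) (a : 'I_m -> F) (nu : 'I_m -> nat).
Hypotheses (a_neq0 : forall k, a k != 0) (a_inj : injective a).

Lemma ntwist_interpolation_inj (e : nat) (Q : {poly F}) :
  (size Q <= \sum_(k < m) nu k)%N ->
  (forall k (l : 'I_(nu k)), (ntwist e l Q).[a k] = 0) -> Q = 0.
Proof.
move=> sQ Q0; apply/eqP; apply: contraLR sQ => Qn0; rewrite -ltnNge.
have dQ : \prod_(k < m) ('X - (a k)%:P) ^+ nu k %| Q.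
  apply: dvdp_prod_XsubC_exp => [|i j _ _ /a_inj //|k _].
    by rewrite /index_enum -enumT enum_uniq.
  by apply: (@dvdp_exp_ntwist _ _ e) => // l lk; apply: (Q0 k (Ordinal lk)).
apply: leq_trans (dvdp_leq Qn0 dQ).
rewrite size_prod => [|k _]; last by rewrite expf_neq0 // polyXsubC_eq0.
under eq_bigr do rewrite size_exp_XsubC -addn1.
by rewrite big_split /= sum_nat_const muln1 cardE subSn ?leq_addl // addnK.
Qed.

(** Rank argument: by [ntwist_interpolation_inj], the matrix M of the evaluation
    map has independent rows; being square, it has a left inverse B. *)
Lemma ntwist_interpolation (e : nat) (w : forall k, 'I_(nu k) -> F) :
  exists2 Q : {poly F}, (size Q <= \sum_(k < m) nu k)%N &
    forall k (l : 'I_(nu k)), (ntwist e l Q).[a k] = w k l.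
Proof.
pose r := (\sum_(k < m) nu k)%N.
(* The conditions, one for each node and each order of derivative. *)
pose S := {k : 'I_m & 'I_(nu k)}.
have cardS : #|{: S}| = r.
  rewrite card_tagged sumnE big_map big_enum /=.
  by apply: eq_bigr => k _; rewrite card_ord.
pose M := \matrix_(j < r, s < #|{: S}|)
  (ntwist e (tagged (enum_val s)) 'X^j).[a (tag (enum_val s))].
have ME (c : 'rV_r) s : (c *m M) 0 s =
    (ntwist e (tagged (enum_val s)) (rVpoly c)).[a (tag (enum_val s))].
  rewrite mxE [in RHS]/rVpoly poly_def linear_sum horner_sum.
  apply: eq_bigr => j _; rewrite linearZ hornerZ mxE insubT //= => jr.
  by congr (c _ _ * _); apply: val_inj.
have freeM : row_free M.
  apply: inj_row_free => c cM0; apply: (can_inj rVpolyK); rewrite linear0.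
  apply: (@ntwist_interpolation_inj e); first exact: size_poly.
  move=> k l; have := ME c (enum_rank (Tagged (fun k => 'I_(nu k)) l)).
  by rewrite cM0 mxE enum_rankK.
have /row_fullP[B BM] : row_full M by rewrite -col_leq_rank (eqP freeM) cardS.
pose v := \row_s w _ (tagged (@enum_val _ {: S} s)).
exists (rVpoly (v *m B)); first exact: size_poly.
move=> k l; have := ME (v *m B) (enum_rank (Tagged (fun k => 'I_(nu k)) l)).
by rewrite -mulmxA BM mulmx1 mxE enum_rankK.
Qed.

End Interpolation.

Lemma is_derive_horner (K : numFieldType) (Q : {poly K}) (z : K) :
  is_derive z (1 : K) (horner Q : K -> K^o) Q^`().[z].
Proof.
elim/poly_ind: Q => [|Q c IHQ].
  rewrite deriv0 horner0.
  have -> : horner (0 : {poly K}) = cst 0 by apply/funext => x; rewrite horner0.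
  exact: is_derive_cst.
have -> : horner (Q * 'X + c%:P) = (horner Q : K -> K^o) * id + cst c.
  by apply/funext => x; rewrite !hornerE.
apply: is_derive_eq; rewrite derivD derivM derivX derivC !hornerE.
by rewrite /GRing.scale /= mulr1 addrC [z * _]mulrC.
Qed.

(** The formula is only assumed off 0 because the value of a Laurent polynomial
    at 0 is a matter of convention; the derivative at z <> 0 does not see it. *)
Lemma derive1_negpow_horner (K : numFieldType) (e : nat) (Q : {poly K})
    (f : K -> K^o) :
  (forall z, z != 0 -> f z = z ^- e * Q.[z]) ->
  forall z, z != 0 -> f^`()%classic z = z ^- e.+1 * (twist e Q).[z].
Proof.
move=> fE z z0.
pose g : K -> K^o := fun z => (z ^+ e)^-1.
have dX : is_derive z (1 : K) (fun z : K => z ^+ e : K^o) (e%:R * z ^+ e.-1).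
  have := is_derive_horner 'X^e z.
  have -> : horner ('X^e) = (fun z : K => z ^+ e).
    by apply/funext => x; rewrite hornerXn.
  by rewrite derivXn hornerMn hornerXn mulr_natl.
have ze0 : z ^+ e != 0 by rewrite expf_neq0.
have dg : is_derive z (1 : K) g (- (z ^+ e) ^- 2 * (e%:R * z ^+ e.-1)).
  apply: DeriveDef; first by apply: derivableV => //; case: dX.
  by rewrite deriveV // derive_val.
have dQ := is_derive_horner Q z.
rewrite derive1E (@near_eq_derive _ _ _ f (g * (horner Q : K -> K^o))); last first.
  have : \forall x \near z, x != 0.
    exists `|z|; first by rewrite /= normr_gt0.
    by move=> x /=; apply: contraTneq => ->; rewrite subr0 ltxx.
  by apply: filterS => x /fE.
rewrite derive_val /GRing.scale /= /g /twist.
rewrite hornerD hornerN hornerM hornerX hornerMn.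
(* The exponent e.-1 in the derivative of z ^+ e is truncated at e = 0. *)
case: (e) => [|n] /=; first by rewrite !expr0 expr1; field.
by rewrite -[Q.[z] *+ _]mulr_natl !exprS; field; rewrite z0 expf_neq0.
Qed.

Lemma derive1n_negpow_horner (K : numFieldType) (e l : nat) (Q : {poly K})
    (f : K -> K^o) :
  (forall z, z != 0 -> f z = z ^- e * Q.[z]) ->
  forall z, z != 0 -> f^`(l)%classic z = z ^- (e + l) * (ntwist e l Q).[z].
Proof.
elim: l e Q f => [|l IHl] e Q f fE; first by rewrite derive1n0 addn0.
rewrite derive1Sn -addSnnS /=; apply: IHl; exact: derive1_negpow_horner.
Qed.

Lemma sum_negpow_horner (K : fieldType) (r p : nat) (c : nat -> K) (z : K) :
  z != 0 -> \sum_(j < r) c j * z ^ (- p%:Z + j%:Z) =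
            z ^- p * (\poly_(j < r) c j).[z].
Proof.
move=> z0; rewrite horner_poly mulr_sumr; apply: eq_bigr => j _.
by rewrite expfzDr // -exprnP -exprnN mulrCA.
Qed.

Theorem theorem3 (R : realType) (m : nat) (zt : 'I_m -> R[i]) (nu : 'I_m -> nat)
    (r : nat) (p : int) (zeta : forall k : 'I_m, 'I_(nu k) -> R[i])
    (m_ge1 : (1 <= m)%N)
    (zt_circle : forall k, `|zt k| = 1)
    (zt_distinct : forall i j, i != j -> zt i != zt j)
    (nu_gt0 : forall k, (0 < nu k)%N)
    (rE : r = (\sum_(k < m) nu k)%N)
    (p_ge0 : 0 <= p) (p_le : p <= r%:Z - 1) :
  exists! P : R[i] -> R[i],
    Laurent (- p) (r%:Z - p - 1) P /\
    forall (k : 'I_m) (l : 'I_(nu k)), (P : R[i] -> R[i]^o)^`(l)%classic (zt k) = zeta k l.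
Proof.
have {zt_circle} zt0 k : zt k != 0.
  by rewrite -normr_eq0 zt_circle oner_neq0.
have zt_inj : injective zt.
  by move=> i j; apply: contra_eq => /zt_distinct.
case: p p_ge0 p_le => // p _ pr.
have width : `|(r%:Z - p%:Z - 1 - - p%:Z)%R|%N.+1 = r by lia.
rewrite /Laurent /= width.
pose Qof (c : nat -> R[i]) := \poly_(j < r) c j.
have derE (c : nat -> R[i]) k (l : 'I_(nu k)) :
    ((fun z : R[i] => \sum_(j < r) c j * z ^ (- p%:Z + j%:Z)) : R[i] -> R[i]^o)
      ^`(l)%classic (zt k) = zt k ^- (p + l) * (ntwist p l (Qof c)).[zt k].
  by apply: derive1n_negpow_horner => // z; apply: sum_negpow_horner.
(* The factor zt k ^+ (p + l) clears the denominator of the l-th derivative. *)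
have [Q sQ Qw] := ntwist_interpolation zt0 zt_inj p
  (fun k l => zt k ^+ (p + l) * zeta k l).
rewrite -rE in sQ.
have QofQ : Qof (nth 0 Q) = Q.
  apply/polyP => j; rewrite coef_poly; case: ltnP => // rj.
  by rewrite nth_default // (leq_trans sQ).
exists (fun z => \sum_(j < r) Q`_j * z ^ (- p%:Z + j%:Z)).
split; first split; first by exists (nth 0 Q).
  by move=> k l; rewrite derE QofQ Qw mulKf // expf_neq0.
move=> _ [[c ->]] cE; apply/funext => z.
suff QcE : Qof c = Q.
  by apply: eq_bigr => j _; rewrite -QcE coef_poly ltn_ord.
apply/eqP; rewrite -subr_eq0; apply/eqP.
apply: (ntwist_interpolation_inj zt0 zt_inj (nu := nu) (e := p)).
  by rewrite -rE (leq_trans (size_polyD _ _)) // geq_max size_polyN sQ size_poly.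
move=> k l; rewrite raddfB hornerD hornerN Qw -cE derE mulVKf ?subrr //.
by rewrite expf_neq0.
Qed.
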